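(* Let $(M,F)$ be a surface of revolution with profile function $m$, endowed with its strongly convex slope metric $F=\frac{\alpha^2}{\alpha-\beta}$. Along any unit speed $F$-geodesic $\mathcal{P}:(0,a)\to M$, $\mathcal{P}(s)=(u(s),v(s))$, with $\frac{du}{ds}\neq0$ for $s\in(0,a)$, we have $$p_2(s)=\left(g_{12}y^1+g_{22}y^2\right)\big|_{(\mathcal{P},\dot{\mathcal{P}})}=\rho\big|_{(\mathcal{P},\dot{\mathcal{P}})}\cdot m^2(u(s))\cdot\frac{dv}{ds}=\nu_F,$$ where $\nu_F$ is a constant.
   Context: Let $I\subset\mathbb{R}$ be an open interval and $m:I\to(0,\infty)$ smooth. The surface of revolution $M\to\mathbb{R}^3$ is $(u,v)\mapsto(m(u)\cos v,\,m(u)\sin v,\,u)$, $u\in I$, $v\in\mathbb{S}^1$. In canonical coordinates of $TM$ with $(y^1,y^2)=(\dot u,\dot v)$, its slope metric is $F=\frac{\alpha^2}{\alpha-\beta}$ with $\alpha=\sqrt{[1+(m')^2]\dot u^2+m^2\dot v^2}$, $\beta=\dot u$. Set $g_{ij}=\frac12\frac{\partial^2F^2}{\partial y^i\partial y^j}$ and $\rho=\frac{\alpha^2(\alpha-2\beta)}{(\alpha-\beta)^3}$. The slope metric is strongly convex when $\alpha>\beta$ and $(g_{ij})$ is positive definite on all nonzero tangent vectors. Unit speed means $F(\mathcal{P},\dot{\mathcal{P}})=1$; along a curve, $(y^1,y^2)=\left(\frac{du}{ds},\frac{dv}{ds}\right)$. *)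

(* Defs.v *)
From Stdlib Require Export Reals.
From Coquelicot Require Export Coquelicot.
Open Scope R_scope.

(* An endpoint may be infinite. *)
Definition in_interval (lo hi : Rbar) (x : R) : Prop :=
  Rbar_lt lo x /\ Rbar_lt x hi.

Definition smooth_on (lo hi : Rbar) (f : R -> R) : Prop :=
  forall (n : nat) (x : R), in_interval lo hi x -> ex_derive_n f n x.

(** * Finsler geometry in a two-dimensional chart *)

Inductive idx : Set := i1 | i2.

Definition sum_idx (f : idx -> R) : R := f i1 + f i2.

Definition coord (i : idx) (y1 y2 : R) : R :=
  match i with i1 => y1 | i2 => y2 end.

(* A function of the canonical coordinates (x^1, x^2, y^1, y^2) of the tangent
   bundle. *)
Definition TM_fun : Type := R -> R -> R -> R -> R.

(* [dx i f] is the partial derivative of f in x^i, [dy i f] the one in y^i. *)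
Definition dx (i : idx) (f : TM_fun) : TM_fun := fun x1 x2 y1 y2 =>
  match i with
  | i1 => Derive (fun t => f t x2 y1 y2) x1
  | i2 => Derive (fun t => f x1 t y1 y2) x2
  end.

Definition dy (i : idx) (f : TM_fun) : TM_fun := fun x1 x2 y1 y2 =>
  match i with
  | i1 => Derive (fun t => f x1 x2 t y2) y1
  | i2 => Derive (fun t => f x1 x2 y1 t) y2
  end.

Definition sq (F : TM_fun) : TM_fun := fun x1 x2 y1 y2 => F x1 x2 y1 y2 ^ 2.

(* g_{ij} = (1/2) d^2 F^2 / dy^i dy^j *)
Definition g (F : TM_fun) (i j : idx) : TM_fun := fun x1 x2 y1 y2 =>
  / 2 * dy i (dy j (sq F)) x1 x2 y1 y2.

Definition det_g (F : TM_fun) : TM_fun := fun x1 x2 y1 y2 =>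
  g F i1 i1 x1 x2 y1 y2 * g F i2 i2 x1 x2 y1 y2
  - g F i1 i2 x1 x2 y1 y2 * g F i2 i1 x1 x2 y1 y2.

(* g^{ij}, the entries of the inverse matrix of (g_{ij}) *)
Definition g_inv (F : TM_fun) (i j : idx) : TM_fun := fun x1 x2 y1 y2 =>
  match i, j with
  | i1, i1 => g F i2 i2 x1 x2 y1 y2
  | i2, i2 => g F i1 i1 x1 x2 y1 y2
  | i1, i2 => - g F i1 i2 x1 x2 y1 y2
  | i2, i1 => - g F i2 i1 x1 x2 y1 y2
  end / det_g F x1 x2 y1 y2.

(* G^i = (1/4) g^{il} ([F^2]_{x^k y^l} y^k - [F^2]_{x^l}) *)
Definition spray (F : TM_fun) (i : idx) : TM_fun := fun x1 x2 y1 y2 =>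
  / 4 * sum_idx (fun l =>
    g_inv F i l x1 x2 y1 y2 *
    (sum_idx (fun k => dx k (dy l (sq F)) x1 x2 y1 y2 * coord k y1 y2)
     - dx l (sq F) x1 x2 y1 y2)).

Definition positive_definite_at (F : TM_fun) (x1 x2 y1 y2 : R) : Prop :=
  forall w1 w2 : R, (w1, w2) <> (0, 0) ->
  0 < sum_idx (fun i => sum_idx (fun j =>
        g F i j x1 x2 y1 y2 * coord i w1 w2 * coord j w1 w2)).

(* The geodesic equations x''^i + 2 G^i(x, x') = 0 on (0, a), for a twice
   differentiable curve c = (c1, c2); together with [unit_speed], these are the
   geodesics parametrized by F-arc length. *)
Definition geodesic (F : TM_fun) (a : R) (c1 c2 : R -> R) : Prop :=
  forall s : R, 0 < s < a ->
  (forall n : nat, (n <= 2)%nat -> ex_derive_n c1 n s /\ ex_derive_n c2 n s) /\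
  Derive_n c1 2 s
    + 2 * spray F i1 (c1 s) (c2 s) (Derive c1 s) (Derive c2 s) = 0 /\
  Derive_n c2 2 s
    + 2 * spray F i2 (c1 s) (c2 s) (Derive c1 s) (Derive c2 s) = 0.

Definition unit_speed (F : TM_fun) (a : R) (c1 c2 : R -> R) : Prop :=
  forall s : R, 0 < s < a -> F (c1 s) (c2 s) (Derive c1 s) (Derive c2 s) = 1.

(** * The slope metric of a surface of revolution

    The surface is (u, v) |-> (m u * cos v, m u * sin v, u); a point is given by
    u and a real angle v, so that a curve in it is given by u and a lift of its
    circle component to the real line.  All objects below are independent of v,
    hence well defined on the surface. *)

Definition alpha (m : R -> R) : TM_fun := fun u v y1 y2 =>
  sqrt ((1 + Derive m u ^ 2) * y1 ^ 2 + m u ^ 2 * y2 ^ 2).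

Definition beta : TM_fun := fun u v y1 y2 => y1.

Definition slope_metric (m : R -> R) : TM_fun := fun u v y1 y2 =>
  alpha m u v y1 y2 ^ 2 / (alpha m u v y1 y2 - beta u v y1 y2).

Definition rho (m : R -> R) : TM_fun := fun u v y1 y2 =>
  alpha m u v y1 y2 ^ 2 * (alpha m u v y1 y2 - 2 * beta u v y1 y2)
  / (alpha m u v y1 y2 - beta u v y1 y2) ^ 3.

Definition strongly_convex_slope (lo hi : Rbar) (m : R -> R) : Prop :=
  forall u v y1 y2 : R, in_interval lo hi u -> (y1, y2) <> (0, 0) ->
  beta u v y1 y2 < alpha m u v y1 y2 /\
  positive_definite_at (slope_metric m) u v y1 y2.

(* Main.v *)
Require Import Defs.
From Stdlib Require Import Lra.

(** The value nu_F is Clairaut's constant.  The metric does not depend on the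
    angle v, so v is a cyclic coordinate of the energy F^2 / 2, and Noether's
    theorem says that its conjugate momentum p_2 = (1/2) d(F^2)/dy^2 is
    conserved along geodesics.

    Since alpha depends on y^2 only through m^2 (y^2)^2, this momentum is
    rho * m^2 * y^2 ([dy2_sq_slope]).  It is homogeneous of degree 1 in y, so
    Euler's identity turns it into g_12 y^1 + g_22 y^2
    ([momentum_diff_euler]).

    For conservation, differentiate the momentum along the curve and replace the
    second derivatives of the coordinates by the geodesic equations.  Contracting
    the spray coefficients with the row (g_12, g_22) undoes the inverse matrix in
    them ([lower_spray]) and leaves half of the Euler-Lagrange expression of F^2
    for v, namely the x^1-derivative of the momentum times y^1: this is exactly
    the term with the opposite sign produced by the motion of u
    ([momentum_conserved]).  The contraction requires (g_ij) to be symmetric and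
    invertible; strong convexity provides the inverse, and keeps alpha away from
    beta, so that everything is differentiable where y^1 <> 0. *)

(** * The slope metric as a function of the coefficients of alpha *)

(** The metric depends on the point only through the coefficients A = 1 + m'^2
    and B = m^2 of alpha^2.  With A, B, y, z as independent variables, one total
    differential serves for the derivatives in x^1, y^1, y^2 and along a
    curve. *)
Definition norm (A B y z : R) : R := sqrt (A * y ^ 2 + B * z ^ 2).

Definition rho_of (a b : R) : R := a ^ 2 * (a - 2 * b) / (a - b) ^ 3.

Definition momentum (A B y z : R) : R := rho_of (norm A B y z) y * B * z.

(** Half the derivative of F^2 in y.  The second summand comes from beta. *)
Definition momentum1 (A B y z : R) : R :=
  rho_of (norm A B y z) y * A * y
  + norm A B y z ^ 4 / (norm A B y z - y) ^ 3.

Definition energy (A B y z : R) : R :=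
  (norm A B y z ^ 2 / (norm A B y z - y)) ^ 2.

Definition norm_diff (A B y z A' B' y' z' : R) : R :=
  (A' * y ^ 2 + 2 * A * y * y' + B' * z ^ 2 + 2 * B * z * z')
  / (2 * norm A B y z).

(** The two fractions are the partial derivatives of [rho_of], which satisfy
    Euler's identity for a function homogeneous of degree 0. *)
Definition momentum_diff (A B y z A' B' y' z' : R) : R :=
  let a := norm A B y z in
  (a * y * (4 * y - a) / (a - y) ^ 4 * norm_diff A B y z A' B' y' z'
   + a ^ 2 * (a - 4 * y) / (a - y) ^ 4 * y') * B * z
  + rho_of a y * (B' * z + B * z').

Definition admissible (A B y z : R) : Prop :=
  0 < A * y ^ 2 + B * z ^ 2 /\ y < norm A B y z.

Lemma norm_pos A B y z : admissible A B y z -> 0 < norm A B y z.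
Proof. intros [H _]; now apply sqrt_lt_R0. Qed.

Lemma norm_sq A B y z :
  admissible A B y z -> norm A B y z ^ 2 = A * y ^ 2 + B * z ^ 2.
Proof. intros [H _]; apply pow2_sqrt; lra. Qed.

Lemma is_derive_norm (A B y z : R -> R) (A' B' y' z' t : R) :
  is_derive A t A' -> is_derive B t B' ->
  is_derive y t y' -> is_derive z t z' ->
  admissible (A t) (B t) (y t) (z t) ->
  is_derive (fun t => norm (A t) (B t) (y t) (z t)) t
    (norm_diff (A t) (B t) (y t) (z t) A' B' y' z').
Proof.
  intros HA HB Hy Hz Hadm.
  assert (Hn := norm_pos _ _ _ _ Hadm).
  destruct Hadm as [Hr _].
  assert (HR : is_derive (fun t => A t * y t ^ 2 + B t * z t ^ 2) t
     (A' * y t ^ 2 + 2 * A t * y t * y' + B' * z t ^ 2 + 2 * B t * z t * z')).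
  { auto_derive.
    - repeat split; eexists; eassumption.
    - rewrite (is_derive_unique (fun x : R => A x) _ _ HA),
        (is_derive_unique (fun x : R => B x) _ _ HB),
        (is_derive_unique (fun x : R => y x) _ _ Hy),
        (is_derive_unique (fun x : R => z x) _ _ Hz); ring. }
  exact (is_derive_sqrt _ _ _ HR Hr).
Qed.

Lemma is_derive_rho_of (a b : R -> R) (a' b' t : R) :
  is_derive a t a' -> is_derive b t b' -> b t < a t ->
  is_derive (fun t => rho_of (a t) (b t)) t
    (a t * b t * (4 * b t - a t) / (a t - b t) ^ 4 * a'
     + a t ^ 2 * (a t - 4 * b t) / (a t - b t) ^ 4 * b').
Proof.
  intros Ha Hb Hlt.
  unfold rho_of; auto_derive.
  - repeat split; try (eexists; eassumption).
    apply Rgt_not_eq.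
    change (0 < (a t - b t) ^ 3); apply pow_lt; lra.
  - rewrite (is_derive_unique (fun x : R => a x) _ _ Ha),
      (is_derive_unique (fun x : R => b x) _ _ Hb).
    field; lra.
Qed.

Lemma is_derive_momentum (A B y z : R -> R) (A' B' y' z' t : R) :
  is_derive A t A' -> is_derive B t B' ->
  is_derive y t y' -> is_derive z t z' ->
  admissible (A t) (B t) (y t) (z t) ->
  is_derive (fun t => momentum (A t) (B t) (y t) (z t)) t
    (momentum_diff (A t) (B t) (y t) (z t) A' B' y' z').
Proof.
  intros HA HB Hy Hz Hadm.
  assert (Hn := is_derive_norm _ _ _ _ _ _ _ _ _ HA HB Hy Hz Hadm).
  assert (Hr := is_derive_rho_of _ _ _ _ _ Hn Hy (proj2 Hadm)).
  assert (H : forall (r : R -> R) (r' : R), is_derive r t r' ->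
    is_derive (fun t => r t * B t * z t) t
      (r' * B t * z t + r t * (B' * z t + B t * z'))).
  { intros r r' Hr'.
    auto_derive.
    - repeat split; eexists; eassumption.
    - rewrite (is_derive_unique (fun x : R => B x) _ _ HB),
        (is_derive_unique (fun x : R => z x) _ _ Hz),
        (is_derive_unique (fun x : R => r x) _ _ Hr').
      ring. }
  exact (H _ _ Hr).
Qed.

Lemma is_derive_energy (A B y z : R -> R) (y' z' t : R) :
  is_derive A t 0 -> is_derive B t 0 ->
  is_derive y t y' -> is_derive z t z' ->
  admissible (A t) (B t) (y t) (z t) ->
  is_derive (fun t => energy (A t) (B t) (y t) (z t)) t
    (2 * (momentum1 (A t) (B t) (y t) (z t) * y'
          + momentum (A t) (B t) (y t) (z t) * z')).
Proof.
  intros HA HB Hy Hz Hadm.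
  assert (Hn := is_derive_norm _ _ _ _ _ _ _ _ _ HA HB Hy Hz Hadm).
  assert (Hpos := norm_pos _ _ _ _ Hadm).
  assert (Hlt := proj2 Hadm).
  assert (H : forall (n : R -> R) (n' : R), is_derive n t n' -> y t < n t ->
    is_derive (fun t => (n t ^ 2 / (n t - y t)) ^ 2) t
      (2 * (n t ^ 3 * (n t - 2 * y t) / (n t - y t) ^ 3 * n'
            + n t ^ 4 / (n t - y t) ^ 3 * y'))).
  { intros n n' Hn' Hny.
    auto_derive.
    - repeat split; try (eexists; eassumption); lra.
    - rewrite (is_derive_unique (fun x : R => y x) _ _ Hy),
        (is_derive_unique (fun x : R => n x) _ _ Hn').
      field; lra. }
  assert (HE := H _ _ Hn Hlt).
  match type of HE with
  | is_derive _ _ ?l =>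
      match goal with |- is_derive _ _ ?r => replace r with l end
  end; [exact HE |].
  cbv beta.
  unfold momentum1, momentum, rho_of, norm_diff.
  field; lra.
Qed.

(** The value is the derivative of the momentum in y: the mixed second
    derivatives of the energy agree, which is the symmetry of (g_ij). *)
Lemma is_derive_momentum1_z A B y z :
  admissible A B y z ->
  is_derive (fun t => momentum1 A B y t) z (momentum_diff A B y z 0 0 1 0).
Proof.
  intros Hadm.
  assert (Hn := is_derive_norm (fun _ => A) (fun _ => B) (fun _ => y)
    (fun t => t) 0 0 0 1 z (is_derive_const _ _) (is_derive_const _ _)
    (is_derive_const _ _) (is_derive_id _) Hadm).
  assert (Hr := is_derive_rho_of _ _ _ _ _ Hn (is_derive_const y z)
    (proj2 Hadm)).
  assert (Hpos := norm_pos _ _ _ _ Hadm).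
  assert (Hlt := proj2 Hadm).
  assert (H : forall (r n : R -> R) (r' n' : R),
    is_derive r z r' -> is_derive n z n' -> y < n z ->
    is_derive (fun t => r t * A * y + n t ^ 4 / (n t - y) ^ 3) z
      (r' * A * y + n z ^ 3 * (n z - 4 * y) / (n z - y) ^ 4 * n')).
  { intros r n r' n' Hr' Hn' Hny.
    auto_derive.
    - repeat split; try (eexists; eassumption).
      apply Rgt_not_eq.
      change (0 < (n z - y) ^ 3); apply pow_lt; lra.
    - rewrite (is_derive_unique (fun x : R => r x) _ _ Hr'),
        (is_derive_unique (fun x : R => n x) _ _ Hn').
      field; lra. }
  assert (HE := H _ _ _ _ Hr Hn Hlt).
  match type of HE with
  | is_derive _ _ ?l =>
      match goal with |- is_derive _ _ ?r => replace r with l end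
  end; [exact HE |].
  cbv beta.
  unfold momentum_diff, rho_of, norm_diff, zero; simpl.
  field; lra.
Qed.

(** Euler's identity: the momentum is homogeneous of degree 1 in (y, z). *)
Lemma momentum_diff_euler A B y z :
  admissible A B y z ->
  momentum_diff A B y z 0 0 1 0 * y + momentum_diff A B y z 0 0 0 1 * z
  = momentum A B y z.
Proof.
  intros Hadm.
  assert (Hpos := norm_pos _ _ _ _ Hadm).
  assert (Hsq := norm_sq _ _ _ _ Hadm).
  assert (Hlt := proj2 Hadm).
  assert (Hn : norm_diff A B y z 0 0 1 0 * y + norm_diff A B y z 0 0 0 1 * z
               = norm A B y z).
  { unfold norm_diff.
    replace (norm A B y z) with (norm A B y z ^ 2 / norm A B y z) at 3
      by (field; lra).
    rewrite Hsq; field; lra. }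
  unfold momentum_diff, momentum; cbv zeta.
  set (a := norm A B y z) in *.
  transitivity
    ((a * y * (4 * y - a) / (a - y) ^ 4
       * (norm_diff A B y z 0 0 1 0 * y + norm_diff A B y z 0 0 0 1 * z)
      + a ^ 2 * (a - 4 * y) / (a - y) ^ 4 * y) * B * z + rho_of a y * B * z).
  - ring.
  - rewrite Hn; field; lra.
Qed.

Lemma momentum_diff_linear A B y z A' B' k y' z' :
  momentum_diff A B y z (A' * k) (B' * k) y' z'
  = momentum_diff A B y z A' B' 0 0 * k
    + momentum_diff A B y z 0 0 1 0 * y'
    + momentum_diff A B y z 0 0 0 1 * z'.
Proof. unfold momentum_diff, norm_diff; cbv zeta; unfold Rdiv; ring. Qed.

(** * Lowering the index of the spray *)

(** The row (g_12, g_22) times the inverse matrix is (0, 1), so of the two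
    Euler-Lagrange expressions in the spray only the one for x^2 survives. *)
Lemma lower_spray F x1 x2 y1 y2 :
  g F i2 i1 x1 x2 y1 y2 = g F i1 i2 x1 x2 y1 y2 ->
  det_g F x1 x2 y1 y2 <> 0 ->
  g F i1 i2 x1 x2 y1 y2 * spray F i1 x1 x2 y1 y2
  + g F i2 i2 x1 x2 y1 y2 * spray F i2 x1 x2 y1 y2
  = / 4 * (sum_idx (fun k => dx k (dy i2 (sq F)) x1 x2 y1 y2 * coord k y1 y2)
           - dx i2 (sq F) x1 x2 y1 y2).
Proof.
  intros Hsym Hdet.
  unfold spray, sum_idx at 1 3; unfold g_inv.
  unfold det_g in *.
  rewrite Hsym in *.
  set (h1 := sum_idx _ - _).
  set (h2 := sum_idx _ - _).
  field; exact Hdet.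
Qed.

Lemma positive_definite_det_g F x1 x2 y1 y2 :
  positive_definite_at F x1 x2 y1 y2 ->
  g F i2 i1 x1 x2 y1 y2 = g F i1 i2 x1 x2 y1 y2 ->
  det_g F x1 x2 y1 y2 <> 0.
Proof.
  intros Hpd Hsym.
  unfold positive_definite_at, sum_idx, coord in Hpd.
  unfold det_g; rewrite Hsym in *.
  set (e := g F i1 i1 x1 x2 y1 y2) in *.
  set (f := g F i1 i2 x1 x2 y1 y2) in *.
  set (h := g F i2 i2 x1 x2 y1 y2) in *.
  assert (He : 0 < e).
  { assert (H := Hpd 1 0); lapply H; [lra | intros E; injection E; lra]. }
  (* On (- f, e), orthogonal to (1, 0), the form takes the value e * det. *)
  assert (H : 0 < e * (e * h - f * f)).
  { assert (H := Hpd (- f) e); lapply H; [lra | intros E; injection E; lra]. }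
  intros E; rewrite E in H; lra.
Qed.

(** * Derivatives of the slope metric on a surface of revolution *)

Definition coefA (m : R -> R) (u : R) : R := 1 + Derive m u ^ 2.

Definition coefB (m : R -> R) (u : R) : R := m u ^ 2.

Lemma in_interval_locally lo hi x :
  in_interval lo hi x -> locally x (in_interval lo hi).
Proof.
  intros [H1 H2].
  apply filter_and.
  - exact (open_Rbar_gt lo x H1).
  - exact (open_Rbar_lt hi x H2).
Qed.

Lemma Derive_double_loc (f h : R -> R) (x l : R) :
  locally x (fun t => f t = 2 * h t) -> is_derive h x l -> Derive f x = 2 * l.
Proof.
  intros Hf Hh.
  rewrite (Derive_ext_loc _ _ _ Hf), Derive_scal, (is_derive_unique _ _ _ Hh).
  reflexivity.
Qed.

Section Slope.

Variables (lo hi : Rbar) (m : R -> R).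
Hypothesis m_smooth : smooth_on lo hi m.
Hypothesis convex : strongly_convex_slope lo hi m.

Lemma slope_admissible u y z :
  in_interval lo hi u -> y <> 0 -> admissible (coefA m u) (coefB m u) y z.
Proof.
  intros Hu Hy; split.
  - assert (0 < y ^ 2) by (apply pow2_gt_0; exact Hy).
    unfold coefA, coefB.
    assert (H1 := Rmult_le_pos _ _ (pow2_ge_0 (Derive m u)) (pow2_ge_0 y)).
    assert (H2 := Rmult_le_pos _ _ (pow2_ge_0 (m u)) (pow2_ge_0 z)).
    lra.
  - apply (convex u 0 y z Hu).
    intros E; injection E; auto.
Qed.

Lemma is_derive_coefA u :
  in_interval lo hi u ->
  is_derive (coefA m) u (Derive (coefA m) u).
Proof.
  intros Hu; apply Derive_correct.
  assert (H := m_smooth 2%nat u Hu); simpl in H.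
  unfold coefA; auto_derive; auto.
Qed.

Lemma is_derive_coefB u :
  in_interval lo hi u ->
  is_derive (coefB m) u (Derive (coefB m) u).
Proof.
  intros Hu; apply Derive_correct.
  assert (H := m_smooth 1%nat u Hu); simpl in H.
  unfold coefB; auto_derive; auto.
Qed.

(** beta does not involve y^2, so only the dependence of alpha on y^2
    contributes, and the common factor is rho. *)
Lemma dy2_sq_slope u v y z :
  in_interval lo hi u -> y <> 0 ->
  dy i2 (sq (slope_metric m)) u v y z
  = 2 * momentum (coefA m u) (coefB m u) y z.
Proof.
  intros Hu Hy.
  apply is_derive_unique.
  replace (2 * momentum (coefA m u) (coefB m u) y z)
    with (2 * (momentum1 (coefA m u) (coefB m u) y z * 0
               + momentum (coefA m u) (coefB m u) y z * 1)) by ring.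
  exact (is_derive_energy (fun _ => coefA m u) (fun _ => coefB m u)
    (fun _ => y) (fun t => t) 0 1 z (is_derive_const _ _) (is_derive_const _ _)
    (is_derive_const _ _) (is_derive_id _) (slope_admissible u y z Hu Hy)).
Qed.

Lemma dy1_sq_slope u v y z :
  in_interval lo hi u -> y <> 0 ->
  dy i1 (sq (slope_metric m)) u v y z
  = 2 * momentum1 (coefA m u) (coefB m u) y z.
Proof.
  intros Hu Hy.
  apply is_derive_unique.
  replace (2 * momentum1 (coefA m u) (coefB m u) y z)
    with (2 * (momentum1 (coefA m u) (coefB m u) y z * 1
               + momentum (coefA m u) (coefB m u) y z * 0)) by ring.
  exact (is_derive_energy (fun _ => coefA m u) (fun _ => coefB m u)
    (fun t => t) (fun _ => z) 1 0 y (is_derive_const _ _) (is_derive_const _ _)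
    (is_derive_id _) (is_derive_const _ _) (slope_admissible u y z Hu Hy)).
Qed.

Lemma g12_slope u v y z :
  in_interval lo hi u -> y <> 0 ->
  g (slope_metric m) i1 i2 u v y z
  = momentum_diff (coefA m u) (coefB m u) y z 0 0 1 0.
Proof.
  intros Hu Hy.
  unfold g; simpl dy at 1.
  rewrite (Derive_double_loc _
    (fun t => momentum (coefA m u) (coefB m u) t z) y
    (momentum_diff (coefA m u) (coefB m u) y z 0 0 1 0)).
  - field.
  - apply filter_imp with (fun t => t <> 0).
    + intros t Ht; now apply dy2_sq_slope.
    + exact (open_neq 0 y Hy).
  - exact (is_derive_momentum (fun _ => coefA m u) (fun _ => coefB m u)
      (fun t => t) (fun _ => z) 0 0 1 0 y (is_derive_const _ _)
      (is_derive_const _ _) (is_derive_id _) (is_derive_const _ _)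
      (slope_admissible u y z Hu Hy)).
Qed.

Lemma g22_slope u v y z :
  in_interval lo hi u -> y <> 0 ->
  g (slope_metric m) i2 i2 u v y z
  = momentum_diff (coefA m u) (coefB m u) y z 0 0 0 1.
Proof.
  intros Hu Hy.
  unfold g; simpl dy at 1.
  rewrite (Derive_double_loc _
    (fun t => momentum (coefA m u) (coefB m u) y t) z
    (momentum_diff (coefA m u) (coefB m u) y z 0 0 0 1)).
  - field.
  - apply filter_forall; intros t; now apply dy2_sq_slope.
  - exact (is_derive_momentum (fun _ => coefA m u) (fun _ => coefB m u)
      (fun _ => y) (fun t => t) 0 0 0 1 z (is_derive_const _ _)
      (is_derive_const _ _) (is_derive_const _ _) (is_derive_id _)
      (slope_admissible u y z Hu Hy)).
Qed.

Lemma g21_slope u v y z :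
  in_interval lo hi u -> y <> 0 ->
  g (slope_metric m) i2 i1 u v y z
  = momentum_diff (coefA m u) (coefB m u) y z 0 0 1 0.
Proof.
  intros Hu Hy.
  unfold g; simpl dy at 1.
  rewrite (Derive_double_loc _
    (fun t => momentum1 (coefA m u) (coefB m u) y t) z
    (momentum_diff (coefA m u) (coefB m u) y z 0 0 1 0)).
  - field.
  - apply filter_forall; intros t; now apply dy1_sq_slope.
  - exact (is_derive_momentum1_z _ _ _ _ (slope_admissible u y z Hu Hy)).
Qed.

Lemma dx1_dy2_sq_slope u v y z :
  in_interval lo hi u -> y <> 0 ->
  dx i1 (dy i2 (sq (slope_metric m))) u v y z
  = 2 * momentum_diff (coefA m u) (coefB m u) y z
          (Derive (coefA m) u) (Derive (coefB m) u) 0 0.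
Proof.
  intros Hu Hy.
  apply (Derive_double_loc _
    (fun t => momentum (coefA m t) (coefB m t) y z)).
  - apply filter_imp with (in_interval lo hi).
    + intros t Ht; now apply dy2_sq_slope.
    + now apply in_interval_locally.
  - exact (is_derive_momentum (coefA m) (coefB m) (fun _ => y) (fun _ => z)
      _ _ 0 0 u (is_derive_coefA u Hu) (is_derive_coefB u Hu)
      (is_derive_const _ _) (is_derive_const _ _)
      (slope_admissible u y z Hu Hy)).
Qed.

(** The angle is cyclic: of the Euler-Lagrange expression for v, only the
    x^1-derivative of the momentum survives. *)
Lemma lower_spray_slope u v y z :
  in_interval lo hi u -> y <> 0 ->
  momentum_diff (coefA m u) (coefB m u) y z 0 0 1 0
    * spray (slope_metric m) i1 u v y z
  + momentum_diff (coefA m u) (coefB m u) y z 0 0 0 1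
    * spray (slope_metric m) i2 u v y z
  = / 2 * momentum_diff (coefA m u) (coefB m u) y z
            (Derive (coefA m) u) (Derive (coefB m) u) 0 0 * y.
Proof.
  intros Hu Hy.
  assert (Hsym : g (slope_metric m) i2 i1 u v y z
                 = g (slope_metric m) i1 i2 u v y z)
    by now rewrite g21_slope, g12_slope.
  assert (Hpd : positive_definite_at (slope_metric m) u v y z).
  { apply (convex u v y z Hu); intros E; injection E; auto. }
  assert (Hx2 : dx i2 (sq (slope_metric m)) u v y z = 0)
    by exact (Derive_const (sq (slope_metric m) u v y z) v).
  assert (Hx2y2 : dx i2 (dy i2 (sq (slope_metric m))) u v y z = 0)
    by exact (Derive_const (dy i2 (sq (slope_metric m)) u v y z) v).
  rewrite <- (g12_slope u v), <- (g22_slope u v) by assumption.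
  rewrite lower_spray by (auto using positive_definite_det_g).
  unfold sum_idx, coord.
  rewrite Hx2, Hx2y2, dx1_dy2_sq_slope by assumption.
  field.
Qed.

(** * Conservation of the angular momentum *)

Lemma momentum_conserved (a : R) (u v : R -> R) (s : R) :
  geodesic (slope_metric m) a u v ->
  0 < s < a -> in_interval lo hi (u s) -> Derive u s <> 0 ->
  is_derive (fun s => momentum (coefA m (u s)) (coefB m (u s))
                        (Derive u s) (Derive v s)) s 0.
Proof.
  intros Hgeo Hs Hu Hy.
  destruct (Hgeo s Hs) as [Hex [E1 E2]].
  change (Derive (Derive u) s
    + 2 * spray (slope_metric m) i1 (u s) (v s) (Derive u s) (Derive v s) = 0)
    in E1.
  change (Derive (Derive v) s
    + 2 * spray (slope_metric m) i2 (u s) (v s) (Derive u s) (Derive v s) = 0)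
    in E2.
  assert (Hu1 : is_derive u s (Derive u s))
    by exact (Derive_correct _ _ (proj1 (Hex 1%nat (le_S _ _ (le_n 1))))).
  assert (Hu2 : is_derive (Derive u) s (Derive (Derive u) s))
    by exact (Derive_correct _ _ (proj1 (Hex 2%nat (le_n 2)))).
  assert (Hv2 : is_derive (Derive v) s (Derive (Derive v) s))
    by exact (Derive_correct _ _ (proj2 (Hex 2%nat (le_n 2)))).
  assert (HA : is_derive (fun s => coefA m (u s)) s
                 (Derive u s * Derive (coefA m) (u s)))
    by exact (is_derive_comp _ _ _ _ _ (is_derive_coefA _ Hu) Hu1).
  assert (HB : is_derive (fun s => coefB m (u s)) s
                 (Derive u s * Derive (coefB m) (u s)))
    by exact (is_derive_comp _ _ _ _ _ (is_derive_coefB _ Hu) Hu1).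
  assert (HM := is_derive_momentum _ _ _ _ _ _ _ _ _ HA HB Hu2 Hv2
    (slope_admissible _ _ _ Hu Hy)).
  assert (Hlow := lower_spray_slope (u s) (v s) (Derive u s) (Derive v s) Hu Hy).
  rewrite !(Rmult_comm (Derive u s)), momentum_diff_linear in HM.
  replace (Derive (Derive u) s) with
    (- 2 * spray (slope_metric m) i1 (u s) (v s) (Derive u s) (Derive v s))
    in HM by lra.
  replace (Derive (Derive v) s) with
    (- 2 * spray (slope_metric m) i2 (u s) (v s) (Derive u s) (Derive v s))
    in HM by lra.
  match type of HM with is_derive _ _ ?l => replace 0 with l; [exact HM | lra] end.
Qed.

End Slope.

Lemma zero_derive_constant (f : R -> R) (a : R) :
  (forall s, 0 < s < a -> is_derive f s 0) ->
  forall s t, 0 < s < a -> 0 < t < a -> f s = f t.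
Proof.
  intros Hf.
  assert (H : forall s t, 0 < s -> s < t -> t < a -> f s = f t).
  { intros s t Hs Hst Ht.
    apply (eq_is_derive f s t); [| exact Hst].
    intros x Hx; apply Hf; lra. }
  intros s t Hs Ht.
  destruct (Rtotal_order s t) as [L | [E | L]].
  - apply H; lra.
  - now rewrite E.
  - symmetry; apply H; lra.
Qed.

Theorem theorem4p12 :
  forall (lo hi : Rbar) (m : R -> R),
    smooth_on lo hi m ->
    (forall x : R, in_interval lo hi x -> 0 < m x) ->
    strongly_convex_slope lo hi m ->
  forall (a : R) (u v : R -> R),
    0 < a ->
    (forall s : R, 0 < s < a -> in_interval lo hi (u s)) ->
    geodesic (slope_metric m) a u v ->
    unit_speed (slope_metric m) a u v ->
    (forall s : R, 0 < s < a -> Derive u s <> 0) ->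
  exists nu_F : R, forall s : R, 0 < s < a ->
    let y1 := Derive u s in
    let y2 := Derive v s in
    g (slope_metric m) i1 i2 (u s) (v s) y1 y2 * y1
      + g (slope_metric m) i2 i2 (u s) (v s) y1 y2 * y2
    = rho m (u s) (v s) y1 y2 * m (u s) ^ 2 * Derive v s /\
    rho m (u s) (v s) y1 y2 * m (u s) ^ 2 * Derive v s = nu_F.
Proof.
  intros lo hi m Hm _ Hconv a u v Ha Hin Hgeo _ Hy.
  pose (P := fun s => momentum (coefA m (u s)) (coefB m (u s))
                        (Derive u s) (Derive v s)).
  exists (P (a / 2)).
  intros s Hs; cbv zeta; split.
  - rewrite (g12_slope lo hi), (g22_slope lo hi); auto.
    apply momentum_diff_euler.
    apply (slope_admissible lo hi); auto.
  - change (P s = P (a / 2)).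
    apply (zero_derive_constant P a); [| exact Hs | lra].
    intros t Ht.
    apply (momentum_conserved lo hi m Hm Hconv a); auto.
Qed.
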